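(* There exist $\delta>0$ and $D$ such that for every $d>D$ the $d$-dimensional hypercube has Brunn-Minkowski curvature at least $\frac{1}{2d}(1+\delta)$; that is, for all nonempty sets $S,T$ of vertices of the $d$-dimensional hypercube, $$|\widehat{m}(S,T)|\ge\sqrt{|S||T|}\;e^{\frac{1+\delta}{16d}d_*(S,T)^2}.$$
   Context: The $d$-dimensional hypercube has vertex set $\{0,1\}^d$ with the Hamming distance $d(\cdot,\cdot)$. For points $a,b$, $$\widehat{m}(a,b)=\{u: d(a,u)=\lfloor d(a,b)/2\rfloor,\ d(a,u)+d(u,b)=d(a,b)\}\cup\{u: d(a,u)=\lceil d(a,b)/2\rceil,\ d(a,u)+d(u,b)=d(a,b)\},$$ $\widehat{m}(S,T)=\bigcup_{s\in S,t\in T}\widehat{m}(s,t)$, and $d_*(S,T)=\min\{d(s,t):s\in S,t\in T\}$. The Brunn-Minkowski curvature is the supremum of the values $K$ such that $|\widehat{m}(S,T)|\ge\sqrt{|S||T|}\,e^{\frac K8d_*(S,T)^2}$ for all nonempty sets $S,T$. *)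

(* Defs.v *)
From mathcomp Require Import all_boot all_order all_algebra.
From mathcomp Require Import all_classical all_reals all_analysis.

Set Implicit Arguments.
Unset Strict Implicit.
Unset Printing Implicit Defensive.

Import Order.TTheory GRing.Theory Num.Theory.

Notation hypercube d := {ffun 'I_d -> bool}.

Definition hamming (d : nat) (a b : hypercube d) : nat :=
  #|[set i : 'I_d | a i != b i]%SET|.

Definition midpoints (d : nat) (a b : hypercube d) : {set hypercube d} :=
  ([set u : hypercube d | (hamming a u == (hamming a b)./2) &&
                          (hamming a u + hamming u b == hamming a b)] :|:
   [set u : hypercube d | (hamming a u == uphalf (hamming a b)) &&
                          (hamming a u + hamming u b == hamming a b)])%SET.

Definition midpoint_set (d : nat) (S T : {set hypercube d}) :
    {set hypercube d} :=
  (\bigcup_(s in S) \bigcup_(t in T) midpoints s t)%SET.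

(* The default value d bounds every Hamming distance, so it does not affect
   the minimum when S and T are nonempty; see [set_dist_le] and
   [set_dist_attained]. *)
Definition set_dist (d : nat) (S T : {set hypercube d}) : nat :=
  \big[minn/d]_(s in S) \big[minn/d]_(t in T) hamming s t.

Lemma hamming_le (d : nat) (a b : hypercube d) : hamming a b <= d.
Proof. by rewrite -[leqRHS]card_ord max_card. Qed.

Lemma set_dist_le (d : nat) (S T : {set hypercube d}) (s t : hypercube d) :
  s \in S -> t \in T -> set_dist S T <= hamming s t.
Proof.
have bigminn_le (P : pred (hypercube d)) F u :
    P u -> \big[minn/d]_(v | P v) F v <= F u.
  move=> Pu; have := mem_index_enum u; rewrite unlock.
  elim: (index_enum _) => //= v r IH; rewrite inE => /predU1P[<-|/IH le_r].
    by rewrite Pu geq_minl.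
  by case: ifP => // _; rewrite geq_min le_r orbT.
move=> sS tT; apply: leq_trans (bigminn_le _ _ _ sS) _.
exact: (bigminn_le _ _ _ tT).
Qed.

Lemma set_dist_attained (d : nat) (S T : {set hypercube d}) :
  S != finset.set0 -> T != finset.set0 ->
  exists s t, [/\ s \in S, t \in T & set_dist S T = hamming s t].
Proof.
case/finset.set0Pn => s0 s0S /finset.set0Pn[t0 t0T].
pose P m := (m = d) \/
  exists s t, [/\ s \in S, t \in T & m = hamming s t].
have minP m n : P m -> P n -> P (minn m n) by rewrite /minn; case: ifP.
have [dE|//] : P (set_dist S T).
  apply: (big_ind P); [by left|exact: minP|move=> s sS].
  apply: (big_ind P); [by left|exact: minP|move=> t tT].
  by right; exists s, t.
exists s0, t0; split=> //; apply/eqP; rewrite eqn_leq set_dist_le //= dE.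
exact: hamming_le.
Qed.

Section Curvature.
Local Open Scope ring_scope.

Definition BM_inequality (R : realType) (d : nat) (K : R) : Prop :=
  forall S T : {set hypercube d}, S != finset.set0 -> T != finset.set0 ->
    Num.sqrt (#|S|%:R * #|T|%:R) * expR (K / 8%:R * (set_dist S T)%:R ^+ 2)
      <= #|midpoint_set S T|%:R.

Definition BM_curvature (R : realType) (d : nat) : \bar R :=
  ereal_sup [set K%:E | K in [set K : R | BM_inequality d K]%classic]%classic.

End Curvature.

(* Main.v *)
(* Fix a pair (s, t) and match up consecutive positions of the set where s and
   t differ. A bit string e selects one position of each pair (and possibly the
   leftover one); swapping s and t on the selected positions turns (s, t) into
   a pair (m, m') of midpoints, and the swap with the same e leads back. Hence
   |S| |T| is the sum over pairs (m, m') of midpoints of the probability, for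
   uniform e, that (m, m') is sent to some (m_e, m'_e) in S x T. Let f be the
   distance to S. On that event f(m_e) = 0 and f(m'_e) >= d_*. Since m'_e is
   m_{~e}, where ~e complements e, the function f(m_{~e}) - f(m_e) of e, which
   has mean zero, is at least d_* there. It depends on h = ceil(d/2) independent
   bits, each changing either term by at most 2, so bounded differences bound
   the probability by exp(-d_*^2/(8h)). The curvature is thus at least 1/(2h),
   which is asymptotic to 1/d and at least (1 + 1/2)/(2d) as soon as d > 2. *)
Require Import Defs.
From mathcomp Require Import all_boot all_order all_algebra.
From mathcomp Require Import all_classical all_reals all_analysis.
From mathcomp Require Import zify lra ring.

Set Implicit Arguments.
Unset Strict Implicit.
Unset Printing Implicit Defensive.

Import Order.TTheory GRing.Theory Num.Theory.
Import numFieldNormedType.Exports.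
Local Open Scope ring_scope.

(** * Exponential moments of functions of independent fair bits *)

Lemma is_derive_expRN (R : realType) (t : R) :
  is_derive t 1 (fun x : R => expR (- x)) (- expR (- t)).
Proof.
apply: is_derive_eq (is_derive1_comp (is_derive_expR _) (is_deriveNid t 1)) _.
by rewrite mulrN1.
Qed.

(** The difference [p] of the two sides vanishes at 0 and has derivative t (e^t - e^(-t)), which is
    nonnegative for t >= 0. *)
Lemma sinh_le_mul_cosh (R : realType) (x : R) : 0 <= x ->
  expR x - expR (- x) <= x * (expR x + expR (- x)).
Proof.
move=> x0.
pose p (t : R) := t * (expR t + expR (- t)) - (expR t - expR (- t)).
have dp (t : R) : is_derive t 1 p (t * (expR t - expR (- t))).
  have dN := is_derive_expRN t.
  by apply: is_derive_eq; rewrite /GRing.scale /=; ring.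
have -> : (expR x - expR (- x) <= x * (expR x + expR (- x))) = (p 0 <= p x).
  by rewrite /p oppr0 expR0 mul0r !subrr subr_ge0.
apply: (@ger0_derive1_ndecry _ p 0) => //.
- move=> t; rewrite in_itv /= andbT => t0.
  rewrite derive1E derive_val mulr_ge0 ?(ltW t0) // subr_ge0 ler_expR; lra.
- apply: continuous_subspaceT => t; apply: differentiable_continuous.
  by apply/derivable1_diffP.
Qed.

(** By evenness take x >= 0. There the quotient [q] of the left side by e^(t^2/2) is nonincreasing:
    its derivative has the sign of sinh t - t cosh t. *)
Lemma cosh_le_expR (R : realType) (x : R) :
  expR x + expR (- x) <= 2 * expR (x ^+ 2 / 2).
Proof.
wlog x0 : x / 0 <= x => [H|].
  case: (leP 0 x) => [/H//|/ltW]; rewrite -oppr_ge0 => /H.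
  by rewrite opprK sqrrN addrC.
pose q (t : R) := (expR t + expR (- t)) * expR (- (t ^+ 2 / 2)).
have dq (t : R) : is_derive t 1 q (expR (- (t ^+ 2 / 2)) *
    ((expR t - expR (- t)) - t * (expR t + expR (- t)))).
  have dN := is_derive_expRN t.
  have dg : is_derive t 1 (fun x : R => expR (- (x ^+ 2 / 2)))
      (- t * expR (- (t ^+ 2 / 2))).
    have dsq : is_derive t 1 (fun x : R => - (x ^+ 2 / 2)) (- t).
      by apply: is_derive_eq; rewrite /GRing.scale /=; field.
    apply: is_derive_eq (is_derive1_comp (is_derive_expR _) dsq) _.
    by rewrite mulrC.
  by apply: is_derive_eq; rewrite /GRing.scale /=; ring.
suff : q x <= q 0.
  rewrite /q oppr0 expr0n /= mul0r oppr0 expR0 mulr1 (expRN (_ / 2)).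
  by rewrite ler_pdivrMr ?expR_gt0.
apply: (@ler0_derive1_nincry _ q 0) => //.
- move=> t; rewrite in_itv /= andbT => t0.
  rewrite derive1E derive_val mulr_ge0_le0 ?expR_ge0 // subr_le0.
  exact/sinh_le_mul_cosh/ltW.
- apply: continuous_subspaceT => t; apply: differentiable_continuous.
  by apply/derivable1_diffP.
Qed.

(** Hoeffding's lemma for a fair choice between two values: factor out the mean and apply the cosh
    bound to the half-difference. *)
Lemma two_point_mgf (R : realType) (u v : R) :
  expR u + expR v <= 2 * expR ((u + v) / 2 + (u - v) ^+ 2 / 8).
Proof.
have := cosh_le_expR ((u - v) / 2).
rewrite -(ler_pM2l (expR_gt0 ((u + v) / 2))) mulrDr mulrCA -!expRD.
have -> : (u + v) / 2 + (u - v) / 2 = u by field.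
have -> : (u + v) / 2 - (u - v) / 2 = v by field.
by have -> : ((u - v) / 2) ^+ 2 / 2 = (u - v) ^+ 2 / 8 by field.
Qed.

Lemma sum_tuple_cons (V : nmodType) (h : nat) (F : seq bool -> V) :
  \sum_(e : h.+1.-tuple bool) F e =
    \sum_(e : h.-tuple bool) F (true :: e)
      + \sum_(e : h.-tuple bool) F (false :: e).
Proof.
transitivity (\sum_(b : bool) \sum_(e : h.-tuple bool) F (b :: e)); last first.
  by rewrite big_bool.
rewrite (reindex (fun p : bool * h.-tuple bool => [tuple of p.1 :: p.2])) /=.
  by rewrite (pair_bigA _ (fun b (e : h.-tuple bool) => F (b :: e))).
exists (fun e => (thead e, behead_tuple e)) => [[b e] _|e _] /=.
  by congr pair; apply: val_inj.
by apply: val_inj; rewrite /= [in RHS](tuple_eta e).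
Qed.

(** Induction on the number of bits, conditioning on the first one. The two conditional means differ
    by at most [c], so merging them by [two_point_mgf] costs one more c^2/8. Taking [g] on all
    sequences lets the induction hypothesis apply to [g (b :: e)]. *)
Lemma bounded_differences_mgf (R : realType) (h : nat) (g : seq bool -> R)
    (c : R) :
  (forall p x y q, `|g (p ++ x :: q) - g (p ++ y :: q)| <= c) ->
  \sum_(e : h.-tuple bool) expR (g e) <=
    2 ^+ h * expR ((\sum_(e : h.-tuple bool) g e) / 2 ^+ h
                   + h%:R * (c ^+ 2 / 8)).
Proof.
elim: h g => [|h IH] g gc.
  have sum0 (F : seq bool -> R) : \sum_(e : 0.-tuple bool) F e = F [::].
    rewrite (bigD1 [tuple]) //= big_pred0 ?addr0 // => e.
    exact/negbTE/negPn/eqP/tuple0.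
  by rewrite (sum0 (fun e => expR (g e))) sum0 expr0 mul1r divr1 mul0r addr0.
rewrite (sum_tuple_cons h (fun e => expR (g e))) sum_tuple_cons.
set A := \sum_(e : h.-tuple bool) g (true :: e).
set B := \sum_(e : h.-tuple bool) g (false :: e).
have H2 : (2 : R) ^+ h != 0 by rewrite expf_neq0.
have HP : 0 < (2 : R) ^+ h by rewrite exprn_gt0.
set s := h%:R * (c ^+ 2 / 8).
have IHb b := IH (fun e : seq bool => g (b :: e)) (fun p => gc (b :: p)).
apply: le_trans (lerD (IHb true) (IHb false)) _.
rewrite -/A -/B -/s -mulrDr exprSr -[leRHS]mulrA ler_pM2l //.
apply: le_trans (two_point_mgf _ _) _; rewrite ler_pM2l // ler_expR.
have -> (a b : R) : (a + s + (b + s)) / 2 + (a + s - (b + s)) ^+ 2 / 8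
    = (a + b) / 2 + (s + (a - b) ^+ 2 / 8) by field.
have -> : (A + B) / (2 ^+ h * 2) = (A / 2 ^+ h + B / 2 ^+ h) / 2 by field.
rewrite lerD2l -[h.+1%:R]natr1 mulrDl mul1r -/s lerD2l ler_pM2r ?invr_gt0 //.
(* Left to show: the means over the two halves differ by at most [c], which holds term by term. *)
rewrite -real_normK ?num_real // ler_sqr ?nnegrE //; last first.
  exact: le_trans (normr_ge0 _) (gc [::] true false [::]).
rewrite -mulrBl normrM normfV [`|2 ^+ h|]gtr0_norm // ler_pdivrMr //.
rewrite /A /B -sumrB; apply: le_trans (ler_norm_sum _ _ _) _.
have gc0 (e : h.-tuple bool) := gc [::] true false e.
apply: le_trans (ler_sum _ (fun e _ => gc0 e)) _.
by rewrite sumr_const card_tuple card_bool -[c *+ _]mulr_natr natrX.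
Qed.

(** * Crossover of two vertices along a bit string *)

Section Crossover.
Local Open Scope nat_scope.

Variable d : nat.
Implicit Types (a b : hypercube d) (X : {set 'I_d}) (e : seq bool).

Definition differ a b : {set 'I_d} := [set i | a i != b i]%SET.

Definition cross a b (s : 'I_d -> bool) : hypercube d :=
  [ffun i => if s i then b i else a i].

(* The paired positions have ranks 2j and 2j+1 in the enumeration of X; bit j of
   e decides which of the two is selected. *)
Definition code X e (i : 'I_d) : bool :=
  let r := index i (enum X) in nth false e r./2 (+) odd r.

Definition crossover a b e : hypercube d := cross a b (code (differ a b) e).

Lemma differC a b : differ a b = differ b a.
Proof. by apply/setP => i; rewrite !inE eq_sym. Qed.

(** Swapping values keeps the set of differing positions, so the same [e] selects the same positions
    and the second swap undoes the first. *)
Lemma crossoverK a b e :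
  crossover (crossover a b e) (crossover b a e) e = a.
Proof.
have D : differ (crossover a b e) (crossover b a e) = differ a b.
  apply/setP => i; rewrite !inE !ffunE (differC b a).
  by case: (code _ _ i); rewrite // eq_sym.
rewrite {1}/crossover D; apply/ffunP => i.
by rewrite !ffunE (differC b a); case: (code _ _ i).
Qed.

Lemma index_enum_lt X i : i \in X -> index i (enum X) < d.
Proof.
move=> iX; apply: leq_trans (_ : size (enum X) <= d).
  by rewrite index_mem mem_enum.
by rewrite -cardE -[leqRHS]card_ord max_card.
Qed.

(** Complementing the bits complements the selection. The length bound ensures that every bit read
    lies in [e], since the default [false] of [nth] would not be negated. *)
Lemma crossover_negb a b e : uphalf d <= size e ->
  crossover b a e = crossover a b (map negb e).
Proof.
move=> le_e; apply/ffunP => i; rewrite !ffunE (differC b a).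
have [iX|] := boolP (i \in differ a b); last first.
  by rewrite inE negbK => /eqP->; rewrite !if_same.
have lt_i := index_enum_lt iX.
rewrite /code (nth_map false); last exact: leq_trans (uphalf_leq lt_i) le_e.
by rewrite addNb; case: (_ (+) _).
Qed.

Lemma sum_index X (F : nat -> nat) :
  \sum_(i in X) F (index i (enum X)) = \sum_(0 <= j < #|X|) F j.
Proof.
case: (pickP [in X]) => [x0 _|X0]; last first.
  by rewrite (eq_card0 X0) big_geq // big_pred0.
rewrite -big_enum (big_nth x0) -cardE big_nat [RHS]big_nat.
apply: eq_bigr => j /andP[_ lt_j].
by rewrite index_uniq ?enum_uniq // -cardE.
Qed.

(** Each full pair contributes exactly 1, and a leftover position contributes 0 or 1. *)
Lemma sum_code l e :
  let k := \sum_(0 <= j < l) (nth false e j./2 (+) odd j) in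
  (k == l./2) || (k == uphalf l).
Proof.
have even_sum q : \sum_(0 <= j < q.*2) (nth false e j./2 (+) odd j) = q.
  elim: q => [|q IH]; first by rewrite big_geq.
  rewrite doubleS 2?big_nat_recr //= IH odd_double /= uphalf_double doubleK.
  by case: (nth _ _ _); rewrite /= ?addn0 addn1.
rewrite /=; move: (odd_double_half l); move: (odd l) (l./2) => b q <-.
case: b; last by rewrite add0n even_sum eqxx.
rewrite add1n big_nat_recr //= even_sum doubleK.
by case: (_ (+) _); rewrite /= ?addn0 ?addn1 eqxx ?orbT.
Qed.

Lemma crossover_midpoint a b e : crossover a b e \in midpoints a b.
Proof.
set X := differ a b; set s := code X e.
have ham_s : hamming a (crossover a b e) = \sum_(i in X) s i.
  rewrite /hamming -sum1_card big_mkcond [RHS]big_mkcond /=.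
  apply: eq_bigr => i _; rewrite !inE !ffunE -/X -/s.
  by case: (s i); rewrite ?eqxx //; case: (_ != _).
have ham_ns : hamming (crossover a b e) b = \sum_(i in X) ~~ s i.
  rewrite /hamming -sum1_card big_mkcond [RHS]big_mkcond /=.
  apply: eq_bigr => i _; rewrite !inE !ffunE -/X -/s.
  by case: (s i); rewrite ?eqxx //; case: (_ != _).
have ham_ab : hamming a b = #|X| by [].
have hamD : hamming a (crossover a b e) + hamming (crossover a b e) b
            == hamming a b.
  rewrite ham_s ham_ns -big_split ham_ab -sum1_card /=; apply/eqP.
  by apply: eq_bigr => i _; case: (s i).
rewrite !inE hamD !andbT ham_s ham_ab.
rewrite (sum_index X (fun r => (nth false e r./2 (+) odd r) : nat)).
exact: sum_code.
Qed.

Lemma hamming_triangle a b c : hamming a c <= hamming a b + hamming b c.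
Proof.
rewrite /hamming -cardsUI; apply: leq_trans (leq_addr _ _).
apply/subset_leq_card/fintype.subsetP => i; rewrite !inE.
by case: (a i); case: (b i); case: (c i).
Qed.

Lemma hamming_sym a b : hamming a b = hamming b a.
Proof. exact: (congr1 (fun X : {set 'I_d} => #|X|) (differC a b)). Qed.

(** The bit at index [size p] is read only at the two positions of the pair with that index. *)
Lemma hamming_crossover a b p x y q :
  hamming (crossover a b (p ++ x :: q)) (crossover a b (p ++ y :: q)) <= 2.
Proof.
set X := differ a b; set j := size p.
case: (pickP [in [set i | crossover a b (p ++ x :: q) i
          != crossover a b (p ++ y :: q) i]%SET]) => [x0 _|H0]; last first.
  by rewrite /hamming (eq_card0 H0).
rewrite /hamming.
pose N := nth x0 (enum X).
apply: leq_trans (_ : #|[set N j.*2; N j.*2.+1]%SET| <= 2); last first.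
  by rewrite cards2; case: (_ != _).
apply/subset_leq_card/fintype.subsetP => i; rewrite !inE !ffunE -/X.
have [iX|] := boolP (i \in X); last first.
  by rewrite inE negbK => /eqP->; rewrite !if_same eqxx.
have Ni : N (index i (enum X)) = i by rewrite /N nth_index // mem_enum.
rewrite /code; set r := index i (enum X) in Ni *.
have [rj|nrj] := eqVneq r./2 j.
  move=> _; rewrite -Ni -(odd_double_half r) rj.
  by case: (odd r); rewrite ?add0n ?add1n eqxx ?orbT.
rewrite !nth_cat -/j; case: ltnP => [_|le_j]; first by rewrite eqxx.
have : 0 < r./2 - j by rewrite subn_gt0 ltn_neqAle eq_sym nrj.
by case: (r./2 - j) => //= n _; rewrite eqxx.
Qed.

End Crossover.

(** * Concentration for a fixed pair of midpoints *)

Lemma set_dist_lipschitz (d : nat) (S : {set hypercube d}) (x y : hypercube d) :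
  S != finset.set0 ->
  (set_dist S [set x]%SET <= set_dist S [set y]%SET + hamming x y)%N.
Proof.
move=> S0; have y0 : [set y]%SET != finset.set0.
  by apply/finset.set0Pn; exists y; rewrite inE.
have [s [t [sS]]] := set_dist_attained S0 y0.
rewrite inE => /eqP-> ->; rewrite (hamming_sym x y).
apply: leq_trans (hamming_triangle s y x).
by apply: set_dist_le; rewrite ?inE.
Qed.

Lemma sum_tuple_negb (V : nmodType) (h : nat) (F : seq bool -> V) :
  \sum_(e : h.-tuple bool) F (map negb e) = \sum_(e : h.-tuple bool) F e.
Proof.
rewrite [RHS](reindex_inj (h := fun e : h.-tuple bool => map_tuple negb e)) //.
by move=> e e' /(congr1 val) /(inj_map (can_inj negbK)) /val_inj.
Qed.

(** The probability bound for one pair, multiplied by the number of bit strings; a Chernoff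
    argument. *)
Lemma crossover_count (R : realType) (d : nat) (S T : {set hypercube d})
    (m m' : hypercube d) : (0 < d)%N -> S != finset.set0 ->
  #|[set e : (uphalf d).-tuple bool |
      (crossover m m' e \in S) && (crossover m' m e \in T)]%SET|%:R
  <= 2 ^+ uphalf d
     * expR (- ((set_dist S T)%:R ^+ 2 / (8 * (uphalf d)%:R))) :> R.
Proof.
move=> d0 S0; set h := uphalf d; set D := set_dist S T; set C := finset _.
have h0 : (h%:R : R) != 0 by rewrite pnatr_eq0 -lt0n uphalf_gt0.
pose k : R := D%:R / (4 * h%:R).
have k0 : 0 <= k by rewrite divr_ge0 // mulr_ge0.
pose f x : R := (set_dist S [set x]%SET)%:R.
have f_lip x y : `|f x - f y| <= (hamming x y)%:R.
  rewrite ler_norml lerNl opprB !lerBlDl /f -!natrD !ler_nat.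
  by rewrite {1}hamming_sym !set_dist_lipschitz.
(* Using [map negb e] instead of the swapped pair makes the two sums cancel under complementation;
   both forms agree on strings of length [h]. One bit moves each of the two distances by at most 2,
   hence the constant [4 * k]. *)
pose g (e : seq bool) : R :=
  k * (f (crossover m m' (map negb e)) - f (crossover m m' e)).
have g_lip p x y q : `|g (p ++ x :: q) - g (p ++ y :: q)| <= 4 * k.
  rewrite -mulrBr normrM (ger0_norm k0) mulrC ler_wpM2r //.
  rewrite opprD addrACA opprK; apply: le_trans (ler_normD _ _) _.
  have -> : (4 : R) = 2 + 2 by ring.
  rewrite lerD //.
    apply: le_trans (f_lip _ _) _; rewrite !map_cat /= ler_nat.
    exact: hamming_crossover.
  rewrite addrC; apply: le_trans (f_lip _ _) _; rewrite ler_nat.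
  exact: hamming_crossover.
have sum_g : \sum_(e : h.-tuple bool) g e = 0.
  rewrite /g -mulr_sumr sumrB.
  by rewrite (sum_tuple_negb _ (fun e => f (crossover m m' e))) subrr mulr0.
have g_C (e : h.-tuple bool) : e \in C -> k * D%:R <= g e.
  rewrite inE => /andP[eS eT]; rewrite ler_wpM2l //.
  have -> : f (crossover m m' e) = 0.
    apply/eqP; rewrite pnatr_eq0 -leqn0.
    rewrite -[leqRHS](_ : hamming (crossover m m' e) (crossover m m' e) = 0%N).
      by apply: set_dist_le; rewrite ?inE.
    by apply: eq_card0 => i; rewrite inE eqxx.
  rewrite subr0 -crossover_negb ?size_tuple // ler_nat.
  have y0 : [set crossover m' m e]%SET != finset.set0.
    by apply/finset.set0Pn; exists (crossover m' m e); rewrite inE.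
  have [s [t [sS]]] := set_dist_attained S0 y0.
  by rewrite inE => /eqP-> ->; exact: set_dist_le.
have := bounded_differences_mgf h g_lip.
rewrite sum_g mul0r add0r => mgf.
rewrite expRN ler_pdivlMr ?expR_gt0 //.
(* k makes the exponent 2 h k^2 - k d_* minimal. *)
have kD : k * D%:R = D%:R ^+ 2 / (8 * h%:R) + h%:R * ((4 * k) ^+ 2 / 8).
  by rewrite /k; field.
rewrite -(ler_pM2r (expR_gt0 (h%:R * ((4 * k) ^+ 2 / 8)))) -mulrA -expRD -kD.
apply: le_trans mgf.
rewrite mulr_natl -sumr_const.
rewrite [leRHS](bigID [in C]) /= ler_wpDr //.
  by apply: sumr_ge0 => e _; exact: expR_ge0.
by apply: ler_sum => e eC; rewrite ler_expR g_C.
Qed.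

(** * Double counting and the curvature bound *)

(** The involution [Phi] on triples (pair, bit string) sends those over S x T injectively to triples
    over pairs of midpoints. *)
Lemma crossover_double_count (d h : nat) (S T : {set hypercube d}) :
  (uphalf d <= h)%N ->
  (#|S| * #|T| * 2 ^ h <=
   \sum_(p in finset.setX (midpoint_set S T) (midpoint_set S T))
     #|[set e : h.-tuple bool |
         (crossover p.1 p.2 e \in S) && (crossover p.2 p.1 e \in T)]%SET|)%N.
Proof.
move=> le_h.
pose Phi (p : hypercube d * hypercube d * h.-tuple bool) :=
  (crossover p.1.1 p.1.2 p.2, crossover p.1.2 p.1.1 p.2, p.2).
have PhiK : involutive Phi by move=> [[a b] e]; rewrite /Phi /= !crossoverK.
pose A := finset.setX (finset.setX S T) [set: h.-tuple bool]%SET.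
have -> : (#|S| * #|T| * 2 ^ h)%N = #|A|.
  by rewrite !cardsX cardsT card_tuple card_bool.
rewrite -sum1_card (reindex_inj (inv_inj PhiK)) /=.
under [leqRHS]eq_bigr do rewrite -sum1_card.
rewrite pair_big_dep /= big_mkcond [leqRHS]big_mkcond /=.
apply: leq_sum => -[[m m'] e] _; rewrite !inE /= andbT.
case: ifP => // /andP[mS m'T]; rewrite andbT.
suff in_M u v : u \in S -> v \in T ->
    (crossover u v e \in midpoint_set S T)
    && (crossover v u e \in midpoint_set S T).
  by have := in_M _ _ mS m'T; rewrite !crossoverK => ->.
move=> uS vT; rewrite (@crossover_negb _ u v) ?size_tuple //.
by apply/andP; split; apply/bigcupP; exists u => //; apply/bigcupP; exists v;
  rewrite ?crossover_midpoint.
Qed.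

Lemma card_midpoint_set (R : realType) (d : nat) (S T : {set hypercube d}) :
  (0 < d)%N -> S != finset.set0 ->
  #|S|%:R * #|T|%:R * expR ((set_dist S T)%:R ^+ 2 / (8 * (uphalf d)%:R))
    <= #|midpoint_set S T|%:R ^+ 2 :> R.
Proof.
move=> d0 S0; set h := uphalf d; set E := (_ / _).
rewrite -ler_pdivlMr ?expR_gt0 // -expRN.
have H2 : 0 < (2 : R) ^+ h by rewrite exprn_gt0.
rewrite -(ler_pM2r H2) -natrX -!natrM.
have := crossover_double_count S T (leqnn h); rewrite -(ler_nat R).
move=> /le_trans; apply; rewrite natr_sum.
apply: le_trans (ler_sum _ (fun p _ => crossover_count R T p.1 p.2 d0 S0)) _.
rewrite sumr_const cardsX -[leLHS]mulr_natl natrM natrX -expr2 -/h -/E.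
by rewrite mulrA [leRHS]mulrAC.
Qed.

Lemma sqrt_midpoint_set_le (R : realType) (d : nat) (S T : {set hypercube d}) :
  (2 < d)%N -> S != finset.set0 ->
  Num.sqrt (#|S|%:R * #|T|%:R) *
    expR ((1 + 2^-1) / (16 * d%:R) * (set_dist S T)%:R ^+ 2)
    <= #|midpoint_set S T|%:R :> R.
Proof.
move=> d2 S0; rewrite -ler_sqr ?nnegrE ?mulr_ge0 ?sqrtr_ge0 ?expR_ge0 //.
rewrite exprMn sqr_sqrtr ?mulr_ge0 //.
apply: le_trans (card_midpoint_set R T (ltnW (ltnW d2)) S0).
rewrite ler_wpM2l ?mulr_ge0 // -expRM_natl ler_expR.
rewrite mulrA [leRHS]mulrC ler_wpM2r ?sqr_ge0 //.
have d_gt0 : 0 < d%:R :> R by rewrite ltr0n; lia.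
have h_gt0 : 0 < (uphalf d)%:R :> R by rewrite ltr0n; lia.
(* After squaring, the exponents compare as (1 + delta)/(8d) <= 1/(8h), that is 1 + delta <= d/h.
   For d > 2 the ratio d/h is least at d = 3, where it is 3/2; this fixes delta = 1/2. *)
have h3 : (3 * uphalf d)%:R <= (2 * d)%:R :> R by rewrite ler_nat; lia.
rewrite !natrM in h3.
rewrite -[leRHS]mul1r ler_pdivlMr ?mulr_gt0 //.
have -> : 2 * ((1 + 2^-1) / (16 * d%:R)) * (8 * (uphalf d)%:R)
          = (3 * (uphalf d)%:R) / (2 * d%:R) :> R.
  by field; rewrite gt_eqF.
by rewrite ler_pdivrMr ?mulr_gt0 // mul1r.
Qed.

Theorem proposition3p19 (R : realType) :
  exists (delta : R) (D : nat), 0 < delta /\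
    forall d : nat, (D < d)%N ->
      ((1 / (2 * d%:R) * (1 + delta))%:E <= BM_curvature R d)%E /\
      forall S T : {set hypercube d}, S != finset.set0 -> T != finset.set0 ->
        Num.sqrt (#|S|%:R * #|T|%:R) *
          expR ((1 + delta) / (16 * d%:R) * (set_dist S T)%:R ^+ 2)
          <= #|midpoint_set S T|%:R :> R.
Proof.
exists 2^-1, 2%N; split=> [|d d2]; first by rewrite invr_gt0.
split=> [|S T S0 _]; last exact: sqrt_midpoint_set_le.
apply: ereal_sup_ubound; eexists; last reflexivity.
move=> S T S0 _.
have -> : 1 / (2 * d%:R) * (1 + 2^-1) / 8 = (1 + 2^-1) / (16 * d%:R) :> R.
  by field; rewrite pnatr_eq0 -lt0n (ltnW (ltnW d2)).
exact: sqrt_midpoint_set_le.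
Qed.
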